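(* Let $H$ be a fixed bipartite graph with $B > 2$ vertices. Then there is a constant $c = c(H) > 0$ (independent of $n$ and $d$) such that for all integers $n \ge 1$ and $d \ge 1$, every $n$-vertex $d$-regular graph $G$ that does not contain $H$ as a (not necessarily induced) subgraph contains an induced matching of size at least $c \cdot \frac{n}{d}\log d$. In asymptotic notation: such a $G$ contains an induced matching of size $\Omega\!\left(\frac{n}{d}\log d\right)$.
   Context: All graphs are finite, simple and undirected. An induced matching in a graph $G$ is a matching $M$ (a set of pairwise vertex-disjoint edges) such that no edge of $G$ joins an endpoint of one edge of $M$ to an endpoint of a different edge of $M$. The implied constant in $\Omega$ may depend on $H$ but not on $n$ or $d$. *)

(* Defs.v *)
From mathcomp Require Import all_boot.

Set Implicit Arguments.
Unset Strict Implicit.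
Unset Printing Implicit Defensive.

Record sgraph := SGraph {
  vertex :> finType;
  adj : rel vertex;
  adj_sym : symmetric adj;
  adj_irrefl : irreflexive adj
}.

Definition regular (G : sgraph) (d : nat) : Prop :=
  forall x : G, #|[set y | adj x y]| = d.

(* [side] is a proper 2-colouring of the vertices. *)
Definition bipartite (G : sgraph) : Prop :=
  exists side : G -> bool, forall x y : G, adj x y -> side x != side y.

(* Non-edges of [H] are unconstrained: the copy of [H] need not be induced. *)
Definition has_subgraph (G H : sgraph) : Prop :=
  exists f : H -> G, injective f /\ forall x y : H, adj x y -> adj (f x) (f y).

Definition edges (G : sgraph) : {set {set G}} :=
  [set [set p.1; p.2] | p : G * G & adj p.1 p.2].

Definition matching (G : sgraph) (M : {set {set G}}) : Prop :=
  M \subset edges G /\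
  forall a b : {set G}, a \in M -> b \in M -> a != b -> [disjoint a & b].

Definition induced_matching (G : sgraph) (M : {set {set G}}) : Prop :=
  matching M /\
  forall a b : {set G}, a \in M -> b \in M -> a != b ->
  forall x y : G, x \in a -> y \in b -> ~~ adj x y.

(* Main.v *)
(**
An induced matching of [G] is an independent set of edges for the relation
"equal or joined by an edge", in which every edge meets at most
[Delta = 4 d^2] others. Since a dense spot between two neighbourhoods would
contain [H] (Kovari-Sos-Turan), the edges in conflict with a given one span at
most [O(Delta^2 / k^4)] conflicts, where [k] is a small power of [d].

In such a locally sparse graph, draw an independent set [W] from the hard-core
measure (weight [lam ^ #|W|]) with [lam = k^2 / Delta]. For a vertex [v],
condition on the part of [W] outside the closed neighbourhood of [v]: what is
left is either [{v}] or an independent subset of the set [A] of neighbours of [v]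
still available. If the partition function [Z] of [A] is at most [k], then [v]
is chosen with probability at least about [k^2 / (Delta k)]; otherwise
[k < Z <= (1 + lam) ^ #|A|] makes [A] large, local sparsity makes its vertices
nearly independent, and [W] meets [A] in at least [ln k / 2] vertices on average.
Either way [Delta * P(v in W) + E #|W :&: N(v)|] is at least [ln k / 4],
and summing over [v] gives [2 Delta E #|W| >= #|V| ln k / 4].
*)
Require Import Defs.
From mathcomp Require Import all_boot all_order all_algebra.
From mathcomp Require Import zify ring lra.
From mathcomp Require Import reals sequences exp.

Import Order.TTheory GRing.Theory Num.Theory.
Local Open Scope ring_scope.

(** * Independent sets in locally sparse graphs *)

Section HardCore.

Context {R : realType} {V : finType} (e : rel V).
Hypotheses (e_sym : symmetric e) (e_irr : irreflexive e).

Definition indep (S : {set V}) := [forall x in S, forall y in S, ~~ e x y].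

Lemma indepP (S : {set V}) :
  reflect {in S &, forall x y, ~~ e x y} (indep S).
Proof.
apply: (iffP forall_inP) => [h x y xS yS|h x xS].
  exact: (forall_inP (h x xS)).
by apply/forall_inP => y yS; apply: h.
Qed.

Lemma indepS (S T : {set V}) : S \subset T -> indep T -> indep S.
Proof.
move=> /subsetP ST /indepP iT; apply/indepP => x y xS yS.
by apply: iT; apply: ST.
Qed.

Variable lam : R.
Hypotheses (lam_ge0 : 0 <= lam).

(* Unnormalised quantities of the hard-core model on the subgraph induced by
   [A]: the partition function, the total size and the weight of [x];
   expectations are [hcY A / hcZ A] and [hcP A x / hcZ A]. *)
Definition hcZ (A : {set V}) : R :=
  \sum_(S : {set V} | (S \subset A) && indep S) lam ^+ #|S|.

Definition hcY (A : {set V}) : R :=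
  \sum_(S : {set V} | (S \subset A) && indep S) lam ^+ #|S| * #|S|%:R.

Definition hcP (A : {set V}) (x : V) : R :=
  \sum_(S : {set V} | (S \subset A) && indep S && (x \in S)) lam ^+ #|S|.

Lemma hcZ_ge1 (A : {set V}) : 1 <= hcZ A.
Proof.
rewrite /hcZ (bigD1 set0) /=; last first.
  by rewrite sub0set; apply/indepP => x y; rewrite inE.
by rewrite cards0 expr0 lerDl sumr_ge0// => S _; rewrite exprn_ge0.
Qed.

(** Dropping independence leaves the sum over all subsets of [A], which factors over the
    vertices. *)
Lemma hcZ_le (A : {set V}) : hcZ A <= (1 + lam) ^+ #|A|.
Proof.
have -> : (1 + lam) ^+ #|A| = \prod_(i : V) ((if i \in A then lam else 0) + 1).
  rewrite (bigID (mem A)) /= [X in _ * X]big1 => [|i /negbTE ->]; last exact: add0r.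
  by rewrite mulr1 -prodr_const; apply: eq_bigr => i ->; rewrite addrC.
rewrite bigA_distr /hcZ big_mkcond /=; apply: ler_sum => S _.
have H0 : 0 <= \prod_(i : V) (if i \in S then if i \in A then lam else 0 else 1).
  by apply: prodr_ge0 => i _; do 2?case: ifP.
case: ifP => // /andP[/subsetP SA _].
rewrite (bigID (mem S)) /= [X in _ * X]big1 => [|i /negbTE ->//].
rewrite mulr1 -prodr_const le_eqVlt; apply/orP; left; apply/eqP.
by apply: eq_bigr => i iS; rewrite iS SA.
Qed.

Lemma hcYE (A : {set V}) : hcY A = \sum_(x in A) hcP A x.
Proof.
rewrite /hcP (exchange_big_dep (fun S : {set V} => (S \subset A) && indep S)) /=; last first.
  by move=> x S _ /andP[].
apply: eq_bigr => S SA; rewrite sumr_const mulr_natr; congr (_ *+ _).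
apply: eq_card => x; rewrite [RHS]unfold_in SA /=.
by have /andP[/subsetP sub _] := SA; apply/idP/andP => [xS|[]//]; rewrite sub.
Qed.

(** Deleting [x] is a bijection from the independent sets containing [x] onto those avoiding [x] and
    its neighbours; it costs one factor [lam]. *)
Lemma hcPE (A : {set V}) (x : V) : x \in A ->
  hcP A x = lam * \sum_(S : {set V} | (S \subset A) && indep S &&
    [forall y in S, (y != x) && ~~ e x y]) lam ^+ #|S|.
Proof.
move=> xA; rewrite /hcP.
rewrite (reindex_onto (fun T : {set V} => x |: T) (fun S : {set V} => S :\ x)) /=; last first.
  by move=> S /andP[_ xS]; rewrite setD1K.
rewrite big_distrr /=; apply: eq_big => [T|T /andP[_ /eqP h]]; last first.
  have xT : x \notin T by rewrite -h !inE eqxx.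
  by rewrite cardsU1 xT exprS.
apply/idP/idP => [/andP[/andP[/andP[/subsetP TA iT] _] /eqP h]|].
  have xT : x \notin T by rewrite -h !inE eqxx.
  rewrite -andbA; apply/and3P; split.
  - by apply/subsetP => y yT; apply: TA; rewrite !inE yT orbT.
  - by apply: indepS iT; apply: subsetUr.
  - apply/forall_inP => y yT; apply/andP; split.
      by apply: contra xT => /eqP <-.
    by apply: (indepP _ iT); rewrite !inE ?eqxx ?yT ?orbT.
move=> /andP[/andP[/subsetP TA /indepP iT] /forall_inP f].
have xT : x \notin T by apply/negP => /f /andP[]; rewrite eqxx.
rewrite setU1K// eqxx andbT !inE eqxx /= andbT; apply/andP; split.
  by apply/subsetP => y; rewrite !inE => /orP[/eqP ->//|/TA].
apply/indepP => y z; rewrite !inE => /orP[/eqP ->|yT] /orP[/eqP ->|zT].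
- by rewrite e_irr.
- by have /andP[] := f z zT.
- by rewrite e_sym; have /andP[] := f y yT.
- exact: iT.
Qed.

Lemma hcP_le (A : {set V}) (x : V) : x \in A -> hcP A x <= lam * hcZ A.
Proof.
move=> xA; rewrite hcPE// ler_wpM2l//.
rewrite [leRHS](bigID (fun S : {set V} => [forall y in S, (y != x) && ~~ e x y])) /=.
by rewrite lerDl sumr_ge0// => S _; rewrite exprn_ge0.
Qed.

(* A set blocking [x] contains [x] or a neighbour of [x]: union bound over
   these, each occurring with probability at most [lam]. *)
Lemma hcP_ge (A : {set V}) (x : V) : x \in A ->
  lam * hcZ A * (1 - lam * (1 + #|[set y in A | e x y]|%:R)) <= hcP A x.
Proof.
move=> xA; rewrite hcPE// -mulrA ler_wpM2l//.
set F := BIG_P.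
set B := [set y in A | (y == x) || e x y].
have -> : 1 + #|[set y in A | e x y]|%:R = #|B|%:R :> R.
  have -> : B = x |: [set y in A | e x y].
    apply/setP => y; rewrite !inE; case: (eqVneq y x) => [->|_] /=; last by [].
    by rewrite xA.
  by rewrite cardsU1 !inE e_irr andbF /= natrD.
have -> : \sum_(S | F S) lam ^+ #|S| = hcZ A - \sum_(S : {set V} | (S \subset A) && indep S
    && ~~ [forall y in S, (y != x) && ~~ e x y]) lam ^+ #|S|.
  rewrite /hcZ [X in X - _](bigID (fun S : {set V} => [forall y in S, (y != x) && ~~ e x y])) /=.
  by rewrite addrK.
rewrite mulrBr mulr1 lerD2l lerN2.
apply: (@le_trans _ _ (\sum_(y in B) hcP A y)); last first.
  rewrite [leRHS](_ : _ = \sum_(y in B) lam * hcZ A); last first.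
    by rewrite sumr_const -mulr_natr; ring.
  by apply: ler_sum => y; rewrite inE => /andP[yA _]; apply: hcP_le.
rewrite /hcP (exchange_big_dep (fun S : {set V} => (S \subset A) && indep S)) /=; last first.
  by move=> y S _ /andP[].
rewrite big_mkcondr /=; apply: ler_sum => S /andP[/subsetP SA iS].
case: ifP => [|_]; last by apply: sumr_ge0 => y _; rewrite exprn_ge0.
move=> /forall_inPn[y yS]; rewrite negb_and !negbK => hy.
rewrite (bigD1 y) /=; last by rewrite inE SA//= hy yS iS andbT andbT; apply/subsetP.
by rewrite lerDl sumr_ge0// => z _; rewrite exprn_ge0.
Qed.

Lemma hcY_ge (A : {set V}) :
  lam * hcZ A * (#|A|%:R - lam * (#|A| + \sum_(x in A) #|[set y in A | e x y]|)%:R)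
  <= hcY A.
Proof.
rewrite hcYE.
apply: le_trans (_ : \sum_(x in A)
   lam * hcZ A * (1 - lam * (1 + #|[set y in A | e x y]|%:R)) <= _); last first.
  by apply: ler_sum => x xA; apply: hcP_ge.
rewrite -big_distrr /= sumrB -big_distrr /= big_split /= natrD natr_sum.
by rewrite sumr_const.
Qed.

Lemma hc_local (A : {set V}) (Delta k K : R) :
  0 < Delta -> 1 <= k -> lam = k ^+ 2 / Delta -> lam <= 4^-1 ->
  4 * K <= ln k ->
  (\sum_(x in A) #|[set y in A | e x y]|)%:R <= K * Delta ^+ 2 / k ^+ 4 ->
  ln k / 4 * (lam + hcZ A) <= lam * Delta + hcY A.
Proof.
move=> D0 k1 lamE lam4 Kk sA.
have l0 := lam_ge0.
have k0 : 0 < k by lra.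
have Z1 := hcZ_ge1 A.
have lnk0 : 0 <= ln k by apply: ln_ge0.
have lnk : ln k < k by apply: ln_sublinear.
have lamD : lam * Delta = k ^+ 2 by rewrite lamE divfK// gt_eqF.
have YP := hcY_ge A; set S := (\sum_(x in A) _)%N in sA YP.
have Y0 : 0 <= hcY A by apply: sumr_ge0 => W _; rewrite mulr_ge0// exprn_ge0.
(* For [hcZ A <= k] the term [lam * Delta = k ^ 2] alone suffices, since [ln k < k] and
   [lam + hcZ A <= 2 * k]. *)
have [Zk|kZ] := leP (hcZ A) k.
  rewrite lamD; apply: le_trans (_ : k / 4 * (2 * k) <= _); last by nra.
  by apply: ler_pM; lra.
have lnka : ln k < lam * #|A|%:R.
  have : k < expR (lam * #|A|%:R).
    apply: lt_le_trans kZ _; apply: le_trans (hcZ_le A) _.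
    by rewrite expRM_natr lerXn2r ?nnegrE ?expR_ge1Dx ?expR_ge0 ?addr_ge0.
  by rewrite -{1}(lnK k0) ltr_expR.
(* Since [k ^ 4 / Delta ^ 2] is [lam ^ 2], sparsity gives [lam ^ 2 * S <= K <= ln k / 4]. Together
   with [lamA], half of [#|A|] survives in [hcY_ge]. *)
have lamS : lam * S%:R <= #|A|%:R / 4.
  rewrite -(ler_pM2l (_ : 0 < lam)); last by rewrite lamE divr_gt0 ?exprn_gt0.
  have -> : lam * (#|A|%:R / 4) = (lam * #|A|%:R) / 4 by ring.
  apply: le_trans (_ : K <= _); last by lra.
  have -> : K = lam * (lam * (K * Delta ^+ 2 / k ^+ 4)).
    by rewrite lamE; field; rewrite !gt_eqF.
  by rewrite ler_wpM2l// ler_wpM2l.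
have lamA : lam * #|A|%:R <= #|A|%:R / 4.
  have := ler0n R #|A|; nra.
apply: le_trans (_ : lam * Delta + lam * hcZ A * (#|A|%:R / 2) <= _); last first.
  rewrite lerD2l; apply: le_trans YP; rewrite ler_wpM2l//; last first.
    by rewrite natrD; lra.
  by rewrite mulr_ge0//; lra.
apply: le_trans (_ : ln k / 4 * (2 * hcZ A) <= _).
  by rewrite ler_wpM2l//; lra.
have : 0 <= lam * Delta by rewrite lamD exprn_ge0// ltW.
nra.
Qed.

(* [U] is the part of [W] outside the closed neighbourhood of [v]; [L] bounds
   the conditional average from below. *)
Lemma hc_fiber (v : V) (U : {set V}) (Delta L : R) :
  (forall A : {set V}, A \subset [set x | e v x] ->
     L * (lam + hcZ A) <= lam * Delta + hcY A) ->
  0 <= \sum_(W : {set V} | indep W && (W :\: (v |: [set x | e v x]) == U))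
     lam ^+ #|W| * (Delta * (v \in W)%:R + #|[set x in W | e v x]|%:R - L).
Proof.
set N := [set x | e v x] => hA; set P := BIG_P.
have [W0 PW0|noW] := pickP P; last by rewrite big_pred0.
have /andP[iW0 /eqP W0U] := PW0.
have vN : v \notin N by rewrite inE e_irr.
have UN x : x \in U -> (x != v) && (x \notin N).
  by rewrite -W0U !inE => /andP[]; rewrite negb_or.
have iU : indep U by apply: indepS iW0; rewrite -W0U subsetDl.
have vU : v \notin U by apply/negP => /UN; rewrite eqxx.
rewrite (bigID (fun W : {set V} => v \in W)) /=.
(* An independent set containing [v] has no neighbour of [v], so the fibre has exactly one such
   member. *)
rewrite (big_pred1 (v |: U)) /=; last first.
  move=> W; rewrite /= /P; apply/idP/eqP => [/andP[/andP[iW /eqP WU] vW]|->].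
    apply/setP => x; rewrite -WU !inE; case: (eqVneq x v) => [->//|_] /=.
    apply/idP/idP => [xW|/andP[]//].
    by rewrite xW andbT (indepP _ iW).
  rewrite !inE eqxx andbT; apply/andP; split.
    apply/indepP => x y; rewrite !inE => /orP[/eqP ->|xU] /orP[/eqP ->|yU].
    - by rewrite e_irr.
    - by have := UN _ yU; rewrite inE => /andP[].
    - by have := UN _ xU; rewrite inE e_sym => /andP[].
    - exact: (indepP _ iU).
  apply/eqP/setP => x; rewrite !inE; case: (eqVneq x v) => [->|xv] /=.
    by rewrite (negbTE vU).
  by apply/andP/idP => [[]//|xU]; have := UN _ xU; rewrite !inE xv.
have NvU : [set x in v |: U | e v x] = set0.
  apply/setP => x; rewrite !inE; apply/negbTE; rewrite negb_and negb_or.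
  case: (eqVneq x v) => [->|xv] /=; first by rewrite e_irr.
  by case: (boolP (x \in U)) => // /UN; rewrite inE => /andP[].
rewrite NvU cards0 setU11 cardsU1 vU exprS.
(* The members of the fibre without [v] are the sets [U :|: S] with [S] an independent subset of
   [A]. *)
set A := [set x in N | [forall y in U, ~~ e x y]].
have AN : A \subset N by apply/subsetP => x; rewrite inE => /andP[].
have -> : \sum_(W : {set V} | P W && (v \notin W))
     lam ^+ #|W| * (Delta * (v \in W)%:R + #|[set x in W | e v x]|%:R - L)
  = \sum_(S : {set V} | (S \subset A) && indep S)
     lam ^+ #|U| * (lam ^+ #|S| * (#|S|%:R - L)).
  rewrite (reindex_onto (fun S : {set V} => U :|: S) (fun W : {set V} => W :&: N)) /=.
    apply: eq_big => [S|S /andP[/andP[_ vS] /eqP SE]]; last first.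
      have SN : S \subset N by rewrite -SE subsetIr.
      have -> : [set x in U :|: S | e v x] = S.
        by rewrite -[RHS]SE; apply/setP => x; rewrite !inE.
      have dis : [disjoint U & S].
        rewrite disjoint_subset; apply/subsetP => x /UN /andP[_].
        by apply: contra; apply: (subsetP SN).
      rewrite (negbTE vS) mulr0 add0r cardsU disjoint_setI0// cards0 subn0.
      by rewrite exprD mulrA.
    apply/idP/idP => [/andP[/andP[/andP[iW _] vS] /eqP SE]|/andP[SA iS]].
      rewrite (indepS _ _ (subsetUr U S) iW) andbT.
      apply/subsetP => x xS; rewrite inE; apply/andP; split.
        by move: xS; rewrite -SE inE => /andP[].
      apply/forall_inP => y yU; apply: (indepP _ iW).
        by rewrite inE xS orbT.
      by rewrite inE yU.
    have SN := subset_trans SA AN.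
    have SU x y : x \in S -> y \in U -> ~~ e x y.
      by move=> /(subsetP SA); rewrite !inE => /andP[_ /forall_inP]; apply.
    rewrite /P -!andbA; apply/and4P; split.
    - apply/indepP => x y; rewrite !inE => /orP[xU|xS] /orP[yU|yS].
      + exact: (indepP _ iU).
      + by rewrite e_sym; apply: SU.
      + exact: SU.
      + exact: (indepP _ iS).
    - apply/eqP/setP => x; rewrite in_setD in_setU1 in_setU negb_or.
      case: (boolP (x \in U)) => [/UN ->//|_] /=.
      case: (boolP (x \in S)) => [/(subsetP SN) -> //|]; last by rewrite andbF.
      by rewrite andbF.
    - by rewrite inE negb_or vU /=; apply: contra vN => /(subsetP SN).
    - apply/eqP/setP => x; rewrite in_setI in_setU.
      case: (boolP (x \in U)) => [xU|_] /=.
        have /andP[_ /negbTE xN] := UN _ xU; rewrite xN.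
        by apply/esym/negbTE; apply: contraFN xN => /(subsetP SN).
      by case: (boolP (x \in S)) => //= /(subsetP SN).
  move=> W /andP[/andP[_ /eqP WU] vW]; apply/setP => x.
  rewrite -WU !inE negb_or; case: (eqVneq x v) => [->|xv] /=.
    by rewrite (negbTE vW).
  by case: (e v x); rewrite ?andbT ?andbF ?orbF.
rewrite -big_distrr /= addr0 mulr1 [lam * _]mulrC -mulrA -mulrDr.
rewrite mulr_ge0 ?exprn_ge0//.
have -> : \sum_(S : {set V} | (S \subset A) && indep S) lam ^+ #|S| * (#|S|%:R - L)
   = hcY A - L * hcZ A.
  rewrite /hcY /hcZ big_distrr -sumrB; apply: eq_bigr => S _ /=.
  by ring.
have := hA _ AN; lra.
Qed.

(** First-moment argument: by [hc_fiber] the weighted sum over [W] of [\sum_v X v W] is nonnegative,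
    while double counting bounds each [\sum_v X v W] by [2 * Delta * #|W| - #|V| * L]. *)
Lemma hc_average (Delta L : R) :
  (forall v, #|[set x | e v x]|%:R <= Delta) ->
  (forall (v : V) (A : {set V}), A \subset [set x | e v x] ->
     L * (lam + hcZ A) <= lam * Delta + hcY A) ->
  exists2 W : {set V}, indep W & #|V|%:R * L <= 2 * Delta * #|W|%:R.
Proof.
move=> hdeg hloc.
have [|noW] := pickP (fun W : {set V} => indep W && (#|V|%:R * L <= 2 * Delta * #|W|%:R)).
  by move=> W /andP[iW hW]; exists W.
pose X v (W : {set V}) : R := Delta * (v \in W)%:R + #|[set x in W | e v x]|%:R - L.
have sumX (W : {set V}) : \sum_v X v W <= 2 * Delta * #|W|%:R - #|V|%:R * L.
  rewrite /X !big_split /= sumr_const mulNrn -[L *+ _]mulr_natl lerD2r.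
  have -> : 2 * Delta * #|W|%:R = Delta * #|W|%:R + Delta * #|W|%:R by ring.
  rewrite lerD//.
    rewrite -big_distrr /= -natr_sum -big_mkcond /= sum1_card.
    by rewrite lexx.
  rewrite -natr_sum.
  have -> : (\sum_v #|[set x in W | e v x]| = \sum_(w in W) #|[set x | e w x]|)%N.
    under eq_bigr do rewrite -sum1_card.
    rewrite (exchange_big_dep (mem W)) /=; last by move=> v w _; rewrite inE => /andP[].
    apply: eq_bigr => w wW; rewrite -sum1_card; apply: eq_bigl => v.
    by rewrite !inE wW e_sym.
  rewrite natr_sum mulr_natr -sumr_const; apply: ler_sum => w _; exact: hdeg.
have : 0 <= \sum_(W : {set V} | indep W) lam ^+ #|W| * (\sum_v X v W).
  under eq_bigr do rewrite big_distrr /=.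
  rewrite exchange_big /=; apply: sumr_ge0 => v _.
  rewrite (partition_big (fun W : {set V} => W :\: (v |: [set x | e v x])) xpredT) //=.
  by apply: sumr_ge0 => U _; apply: hc_fiber; apply: hloc.
rewrite leNgt => /negP[].
have neg (W : {set V}) : indep W -> \sum_v X v W < 0.
  move=> iW; apply: le_lt_trans (sumX W) _.
  by have := noW W; rewrite iW /= => /negbT; rewrite -ltNge; lra.
have i0 : indep set0 by apply/indepP => x y; rewrite inE.
(* Other weights vanish if [lam = 0]; the empty set has weight 1 and makes the sum strictly
   negative. *)
rewrite (bigD1 set0) //= cards0 expr0 mul1r.
apply: (@le_lt_trans _ _ (\sum_v X v set0 + 0)); last by rewrite addr0 neg.
rewrite lerD2l; apply: sumr_le0 => W /andP[iW _].
by rewrite mulr_ge0_le0 ?exprn_ge0// ltW// neg.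
Qed.

Lemma sparse_indep (Delta k K : R) :
  0 < Delta -> 1 <= k -> lam = k ^+ 2 / Delta -> lam <= 4^-1 ->
  4 * K <= ln k ->
  (forall v, #|[set x | e v x]|%:R <= Delta) ->
  (forall v, (\sum_(x | e v x) #|[set y | e v y && e x y]|)%:R
    <= K * Delta ^+ 2 / k ^+ 4) ->
  exists2 W : {set V}, indep W & #|V|%:R * ln k <= 8 * Delta * #|W|%:R.
Proof.
move=> D0 k1 lamE lam4 Kk hdeg hsp.
have [v A AN|W iW hW] := hc_average Delta (ln k / 4) hdeg; last first.
  by exists W => //; lra.
apply: (hc_local A Delta k K) => //; apply: le_trans (hsp v); rewrite ler_nat.
rewrite big_mkcond [leqRHS]big_mkcond; apply: leq_sum => x _.
case: ifP => // /(subsetP AN); rewrite inE => ->; apply: subset_leq_card.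
apply/subsetP => y; rewrite !inE => /andP[/(subsetP AN)].
by rewrite inE => -> ->.
Qed.

Lemma hcY_ge_hcZ (A : {set V}) : hcZ A - 1 <= hcY A.
Proof.
have i0 : (set0 \subset A) && indep set0.
  by rewrite sub0set; apply/indepP => x y; rewrite inE.
rewrite /hcZ /hcY (bigD1 set0) //= [leRHS](bigD1 set0) //= !cards0 expr0 mulr0 add0r.
rewrite addrAC subrr add0r; apply: ler_sum => S /andP[_ S0].
by rewrite ler_peMr ?exprn_ge0// ler1n card_gt0.
Qed.

End HardCore.

(* The hard-core argument at fugacity 1, where [Y >= Z - 1] suffices. *)
Lemma bounded_degree_indep {R : realType} {V : finType} (e : rel V) (Delta : R) :
  symmetric e -> irreflexive e -> 1 <= Delta ->
  (forall v, #|[set x | e v x]|%:R <= Delta) ->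
  exists2 W : {set V}, indep e W & #|V|%:R <= 4 * Delta * #|W|%:R.
Proof.
move=> e_sym e_irr D1 hdeg.
have [v A AN|W iW hW] := hc_average e e_sym e_irr 1 ler01 Delta 2^-1 hdeg.
  by have := hcY_ge_hcZ e (1 : R) ler01 A; have := hcZ_ge1 e (1 : R) ler01 A; lra.
by exists W => //; lra.
Qed.

(** At most [s ^ 2 * d ^ (s - 1)] maps from [s] points to [d] points are not injective; the factor
    [d] and the additions avoid truncated subtraction. *)
Lemma expn_le_ffact (d s : nat) : (d * d ^ s <= d * d ^_ s + s ^ 2 * d ^ s)%N.
Proof.
elim: s => [|s IH]; first by rewrite ffactn0 addn0.
have h1 : (d ^_ s <= d ^ s)%N by elim: (s) => // n IHn; rewrite ffactnSr expnSr leq_mul// leq_subr.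
rewrite ffactnSr expnSr.
have h2 : (d ^_ s * d <= d ^_ s * (d - s) + s * d ^ s)%N.
  apply: leq_trans (_ : d ^_ s * (d - s) + d ^_ s * s <= _)%N.
    by rewrite -mulnDr leq_mul2l; apply/orP; right; lia.
  by rewrite leq_add2l mulnC leq_mul2l h1 orbT.
nia.
Qed.

(** * Codegrees in a graph without a given bipartite subgraph *)

Section Graph.

Context {G : sgraph}.
Implicit Types (a b x y : G) (X Y : {set G}).

(** [phi] places one side of [H], an enumeration of [Y] the other. Both maps are defined on all of
    [H], so the sizes of the sides never enter; their images are disjoint because [adj] is
    irreflexive. *)
Lemma biclique_subgraph (H : sgraph) (phi : {ffun H -> G}) (Y : {set G}) :
  bipartite H -> injective phi -> (forall h y, y \in Y -> adj (phi h) y) ->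
  (#|H| <= #|Y|)%N -> has_subgraph G H.
Proof.
move=> [side hside] phi_inj hY leY.
have [y0 y0Y|] := pickP (mem Y); last first.
  move=> Y0; move: leY; rewrite eq_card0 // leqn0 => /eqP H0.
  by exists phi; split => // x; have := fintype0 x H0.
pose psi (h : H) := nth y0 (enum Y) (enum_rank h).
have rk (h : H) : (enum_rank h < size (enum Y))%N.
  by rewrite -cardE (leq_trans _ leY).
have psiY h : psi h \in Y by rewrite -mem_enum mem_nth.
have psi_inj : injective psi.
  move=> h h' /eqP; rewrite nth_uniq ?enum_uniq// => /eqP /val_inj.
  exact: enum_rank_inj.
have neq h h' : phi h != psi h'.
  by apply/eqP => E; have := hY h _ (psiY h'); rewrite E adj_irrefl.
exists (fun h => if side h then phi h else psi h); split.
  move=> h h' /=; case: ifP => _; case: ifP => _.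
  - exact: phi_inj.
  - by move=> /eqP; rewrite (negbTE (neq _ _)).
  - by move=> /esym /eqP; rewrite (negbTE (neq _ _)).
  - exact: psi_inj.
move=> h h' /hside; case: (side h); case: (side h') => // _.
  exact: hY.
by rewrite adj_sym; apply: hY.
Qed.

(* Double counting of maps [H -> X] into the neighbourhood of [y]: an
   injective one has fewer than [#|H|] common neighbours in [Y], and at most
   [#|H|^2 d^(#|H| - 1)] are not injective. *)
Lemma sum_codegree_pow (H : sgraph) (X Y : {set G}) (d : nat) :
  bipartite H -> ~ has_subgraph G H -> #|X| = d -> #|Y| = d ->
  (\sum_(y in Y) #|[set x in X | adj x y]| ^ #|H|
    <= (#|H| + #|H| ^ 2) * d ^ #|H|)%N.
Proof.
move=> hbip noH cX cY.
pose C (phi : {ffun H -> G}) := [set y in Y | [forall h, adj (phi h) y]].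
have -> : (\sum_(y in Y) #|[set x in X | adj x y]| ^ #|H|
    = \sum_(phi : {ffun H -> G} | phi \in ffun_on (mem X)) #|C phi|)%N.
  under eq_bigr do rewrite -card_ffun_on -sum1_card.
  rewrite (exchange_big_dep (mem (ffun_on (mem X)))) /=; last first.
    move=> y phi _ /ffun_onP h; apply/ffun_onP => x.
    by have := h x; rewrite inE => /andP[].
  apply: eq_bigr => phi /ffun_onP phiX; rewrite -sum1_card; apply: eq_bigl => y.
  rewrite [RHS]inE; congr (_ && _); apply/ffun_onP/forallP => h x.
    by have := h x; rewrite inE => /andP[].
  by rewrite inE phiX h.
set s := #|H|.
apply: leq_trans (_ : \sum_(phi : {ffun H -> G} | phi \in ffun_on (mem X))
    (s + ~~ injectiveb phi * d) <= _)%N.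
  apply: leq_sum => phi _.
  have [inj|_] := boolP (injectiveb phi); last first.
    rewrite mul1n -cY (leq_trans _ (leq_addl _ _))//; apply: subset_leq_card.
    by apply/subsetP => y; rewrite inE => /andP[].
  rewrite mul0n addn0 leqNgt; apply/negP => sC; apply: noH.
  apply: (biclique_subgraph H phi (C phi) hbip (injectiveP _ inj)); last exact: ltnW.
  by move=> h y; rewrite inE => /andP[_ /forallP]; apply.
rewrite big_split /= sum_nat_const card_ffun_on cX mulnC mulnDl leq_add2l.
rewrite -big_distrl /= -big_mkcondr /= mulnC.
(* Adding the injective maps to both sides turns the count of non-injective maps into that of all
   maps. *)
rewrite -(leq_add2l (d * d ^_ s)) -[X in X ^_ s]cX -card_inj_ffuns_on -mulnDr.
have -> : (#|[set f : {ffun H -> G} in ffun_on (mem X) | injectiveb f]| +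
    \sum_(phi : {ffun H -> G} | (phi \in ffun_on (mem X)) && ~~ injectiveb phi) 1
    = d ^ s)%N.
  rewrite -[X in (X ^ s)%N]cX -[RHS](@card_ffun_on H G (mem X)) -[RHS]sum1_card.
  by rewrite [RHS](bigID (fun phi : {ffun H -> G} => injectiveb phi)) /= -sum1dep_card.
by rewrite card_inj_ffuns_on cX expn_le_ffact.
Qed.

Definition nbr_edges a b := (\sum_(x | adj a x) \sum_(y | adj b y) adj x y)%N.

(** Codegrees up to [d / g] contribute at most [d ^ 2 / g]; larger ones are controlled by their
    [#|H|]-th powers. The value [g = d ^ (1 / (#|H| + 1))] balances the two. *)
Lemma nbr_edges_le {R : realType} (H : sgraph) (d : nat) (g : R) a b :
  bipartite H -> ~ has_subgraph G H -> regular G d -> (0 < d)%N ->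
  0 < g -> g ^+ #|H|.+1 = d%:R ->
  (nbr_edges a b)%:R <= (1 + #|H| + #|H| ^ 2)%:R * d%:R ^+ 2 / g.
Proof.
move=> hbip noH reg d0 g0 gd; set s := #|H|.
have dR : 0 < d%:R :> R by rewrite ltr0n.
pose D y := #|[set x in [set x | adj a x] | adj x y]|.
have -> : nbr_edges a b = (\sum_(y in [set y | adj b y]) D y)%N.
  rewrite /nbr_edges exchange_big /=; apply: eq_big => [y|y _]; first by rewrite inE.
  by rewrite -big_mkcondr /= sum1dep_card; apply: eq_card => x; rewrite !inE.
have D_le y : (D y <= d)%N.
  by rewrite -(reg a); apply: subset_leq_card; apply/subsetP => x; rewrite inE => /andP[].
have pw y : (D y)%:R <= d%:R / g + d%:R * (g / d%:R) ^+ s * (D y)%:R ^+ s.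
  rewrite -mulrA -exprMn; set u := g / d%:R * (D y)%:R.
  have u0 : 0 <= u by rewrite mulr_ge0// divr_ge0// ltW.
  have [u1|u1] := leP u 1.
    apply: le_trans (_ : d%:R / g <= _); last by rewrite lerDl mulr_ge0// exprn_ge0.
    rewrite ler_pdivlMr// mulrC -(ler_pM2r (_ : 0 < d%:R^-1)) ?invr_gt0//.
    by rewrite mulfV ?gt_eqF// mulrAC.
  apply: le_trans (_ : d%:R * u ^+ s <= _).
    apply: le_trans (_ : d%:R <= _); first by rewrite ler_nat.
    by rewrite ler_peMr// exprn_ege1// ltW.
  by rewrite lerDr divr_ge0// ltW.
rewrite natr_sum; apply: le_trans (ler_sum _ (fun y _ => pw y)) _.
rewrite big_split /= sumr_const reg -big_distrr /=.
have := sum_codegree_pow H [set x | adj a x] [set y | adj b y] d hbip noH (reg a) (reg b).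
rewrite -(ler_nat R) natr_sum.
under eq_bigr do rewrite natrX.
rewrite -/s natrM natrX => hs.
apply: le_trans (_ : (d%:R / g) *+ d + d%:R * (g / d%:R) ^+ s * ((s + s ^ 2)%:R * d%:R ^+ s) <= _).
  by rewrite lerD2l ler_wpM2l// mulr_ge0// exprn_ge0// divr_ge0// ltW.
rewrite le_eqVlt; apply/orP; left; apply/eqP.
have -> : (g / d%:R) ^+ s = d%:R / g / d%:R ^+ s.
  by rewrite expr_div_n -gd -/s exprS [g * _]mulrC mulfK// gt_eqF.
rewrite -mulr_natr !natrD; field.
by rewrite expf_neq0 ?gt_eqF.
Qed.

(** * Conflicts between oriented edges *)

(** Both orientations of an edge are kept, so that sums over edges become sums over neighbours. The
    two are [close], so an independent set holds at most one of them. *)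
Definition darts : {set G * G} := [set p | adj p.1 p.2].

(* Sharing a vertex is a special case: the other end of [p] is then adjacent
   to an end of [q]. *)
Definition close (p q : G * G) : bool :=
  [|| adj p.1 q.1, adj p.1 q.2, adj p.2 q.1 | adj p.2 q.2].

Lemma sum_darts (F : G -> G -> nat) :
  (\sum_(p : {p in darts}) F (val p).1 (val p).2
    = \sum_x \sum_(y | adj x y) F x y)%N.
Proof.
rewrite -(big_sub darts (fun p => F p.1 p.2)) pair_big_dep /=.
by apply: eq_bigl => p; rewrite inE.
Qed.

Lemma sum_darts_flip (F : G -> G -> nat) :
  (\sum_x \sum_(y | adj x y) F y x = \sum_x \sum_(y | adj x y) F x y)%N.
Proof.
rewrite (exchange_big_dep xpredT) //=; apply: eq_bigr => x _.
by apply: eq_bigl => y; rewrite adj_sym.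
Qed.

(** Reversing darts exchanges the terms with [adj a x] and [adj a y], whence the factor 2. *)
Lemma sum_darts_near (F : G -> G -> nat) a : (forall x y, F x y = F y x) ->
  (\sum_x \sum_(y | adj x y) (adj a x + adj a y) * F x y
    = 2 * \sum_(x | adj a x) \sum_(y | adj x y) F x y)%N.
Proof.
move=> symF.
have E : (\sum_x \sum_(y | adj x y) adj a x * F x y
    = \sum_(x | adj a x) \sum_(y | adj x y) F x y)%N.
  rewrite [RHS]big_mkcond; apply: eq_bigr => x _; rewrite -big_distrr /=.
  by case: (adj a x); rewrite ?mul1n ?mul0n.
under eq_bigr => x _ do (under eq_bigr => y _ do rewrite mulnDl; rewrite big_split).
rewrite big_split /= E mul2n -addnn; congr (_ + _)%N; rewrite -E.
rewrite -sum_darts_flip; apply: eq_bigr => x _; apply: eq_bigr => y _.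
by rewrite symF.
Qed.

(** * Degrees and local density of the conflict graph of a regular graph *)

Section Regular.

Context (d : nat) (reg : regular G d).

Lemma regE x : (\sum_(y | adj x y) 1 = d)%N.
Proof. by rewrite sum1dep_card reg. Qed.

Lemma sum_nbr_const x n : (\sum_(y | adj x y) n = d * n)%N.
Proof. by rewrite sum_nat_cond_const reg. Qed.

Lemma sum_nbr_le x (F : G -> nat) n : (forall y, F y <= n)%N ->
  (\sum_(y | adj x y) F y <= d * n)%N.
Proof. by move=> h; rewrite -(sum_nbr_const x); apply: leq_sum => y _; apply: h. Qed.

(** [close] is at most a sum of four adjacencies. For each, the two vertices not involved have [d]
    choices each, and [nbr_edges] counts the rest. *)
Lemma sum_close_pairs T a b : (forall x y, nbr_edges x y <= T)%N ->
  (\sum_(x | adj a x) \sum_(y | adj x y) \sum_(z | adj b z) \sum_(w | adj z w)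
     close (x, y) (z, w) <= 4 * (d * (d * T)))%N.
Proof.
move=> hT.
apply: leq_trans (_ : \sum_(x | adj a x) \sum_(y | adj x y) \sum_(z | adj b z)
  \sum_(w | adj z w) (adj x z + adj x w + adj y z + adj y w) <= _)%N.
  do 4![apply: leq_sum => ? _]; rewrite /close /=.
  by do 4![case: (adj _ _)].
under eq_bigr do under eq_bigr do under eq_bigr do rewrite !big_split /=.
under eq_bigr do under eq_bigr do rewrite !big_split /=.
under eq_bigr do rewrite !big_split /=.
rewrite !big_split /= (_ : 4 * (d * (d * T)) = d * (d * T) + d * (d * T) + d * (d * T)
  + d * (d * T))%N; last by lia.
apply: leq_add; first (apply: leq_add; first apply: leq_add).
- under eq_bigr => x _.
    rewrite sum_nbr_const; under eq_bigr do rewrite sum_nbr_const.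
    rewrite -big_distrr /=; over.
  by rewrite -2!big_distrr /= !leq_mul2l hT !orbT.
- under eq_bigr do rewrite sum_nbr_const.
  rewrite -big_distrr /= exchange_big /= leq_mul2l; apply/orP; right.
  by apply: sum_nbr_le => z; apply: hT.
- apply: sum_nbr_le => x.
  under eq_bigr => y _.
    under eq_bigr do rewrite sum_nbr_const.
    rewrite -big_distrr /=; over.
  by rewrite -big_distrr /= leq_mul2l hT orbT.
- apply: sum_nbr_le => x; rewrite exchange_big /=.
  by apply: sum_nbr_le => z; apply: hT.
Qed.

Lemma close_sym : symmetric close.
Proof.
move=> p q; rewrite /close (adj_sym q.1 p.1) (adj_sym q.1 p.2) (adj_sym q.2 p.1).
by rewrite (adj_sym q.2 p.2); do 4![case: (adj _ _)].
Qed.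

Lemma close_flipr p x y : close p (x, y) = close p (y, x).
Proof. by rewrite /close /=; do 4![case: (adj _ _)]. Qed.

Lemma close_flipl p x y : close (x, y) p = close (y, x) p.
Proof. by rewrite close_sym close_flipr close_sym. Qed.

Definition near a (q : G * G) : nat := (adj a q.1 + adj a q.2)%N.

Lemma close_near p q : (close p q <= near p.1 q + near p.2 q)%N.
Proof. by rewrite /close /near; do 4![case: (adj _ _)]. Qed.

Lemma sum_near a : (\sum_(q : {p in darts}) near a (val q) = 2 * (d * d))%N.
Proof.
rewrite (sum_darts (fun x y => near a (x, y))).
have /= := sum_darts_near (fun _ _ => 1%N) a (fun _ _ => erefl).
rewrite /near /= => E.
under eq_bigr => x _ do under eq_bigr => y _ do rewrite -[(_ + _)%N]muln1.
by rewrite E; under eq_bigr do rewrite regE; rewrite sum_nbr_const.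
Qed.

(** Passing to darts that leave a neighbour of [a] or [b] costs a factor 2 for each of [q] and [r];
    [sum_close_pairs] supplies the 4. *)
Lemma sum_near_close T a b : (forall x y, nbr_edges x y <= T)%N ->
  (\sum_(q : {p in darts}) \sum_(r : {p in darts})
     near a (val q) * (near b (val r) * close (val q) (val r))
   <= 16 * (d * (d * T)))%N.
Proof.
move=> hT.
pose F q := (\sum_(z | adj b z) \sum_(w | adj z w) close q (z, w))%N.
have E q : (\sum_(r : {p in darts}) near b (val r) * close q (val r) = 2 * F q)%N.
  rewrite /F -(sum_darts_near (fun z w => close q (z, w) : nat)) => [|x y]; last first.
    by rewrite close_flipr.
  rewrite -sum_darts; apply: eq_bigr => r _.
  by rewrite -surjective_pairing.
under eq_bigr do rewrite -big_distrr /= E mulnCA.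
rewrite -big_distrr /=.
have -> : (\sum_(q : {p in darts}) near a (val q) * F (val q)
    = 2 * \sum_(x | adj a x) \sum_(y | adj x y) F (x, y))%N.
  rewrite -(sum_darts_near (fun x y => F (x, y))) => [|x y]; last first.
    by apply: eq_bigr => z _; apply: eq_bigr => w _; rewrite close_flipl.
  rewrite -sum_darts; apply: eq_bigr => r _.
  by rewrite -surjective_pairing.
rewrite mulnA (_ : 16 = 2 * 2 * 4)%N // -[leqRHS]mulnA leq_mul2l.
exact: sum_close_pairs.
Qed.

Definition conflict (p q : {p in darts}) : bool := (p != q) && close (val p) (val q).

Lemma conflict_sym : symmetric conflict.
Proof. by move=> p q; rewrite /conflict eq_sym close_sym. Qed.

Lemma conflict_irr : irreflexive conflict.
Proof. by move=> p; rewrite /conflict eqxx. Qed.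

Lemma conflict_degree p : (#|[set q | conflict p q]| <= 4 * d ^ 2)%N.
Proof.
rewrite -sum1dep_card big_mkcond /=.
apply: leq_trans (_ : \sum_(q : {p in darts})
    (near (val p).1 (val q) + near (val p).2 (val q)) <= _)%N.
  apply: leq_sum => q _; apply: leq_trans (close_near _ _).
  by rewrite /conflict; case: (p != q) => //=; case: (close _ _).
by rewrite big_split /= !sum_near; lia.
Qed.

(** Each of [q] and [r] is near an end of [p]: four choices of ends, each contributing at most
    [16 * (d * (d * T))]. *)
Lemma conflict_sparse T p : (forall x y, nbr_edges x y <= T)%N ->
  (\sum_(q | conflict p q) #|[set r | conflict p r && conflict q r]|
    <= 64 * (d * (d * T)))%N.
Proof.
move=> hT; set u := (val p).1; set v := (val p).2.
pose M a b := (\sum_(q : {p in darts}) \sum_(r : {p in darts})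
     near a (val q) * (near b (val r) * close (val q) (val r)))%N.
apply: leq_trans (_ : M u u + M u v + M v u + M v v <= _)%N; last first.
  have hM a b : (M a b <= 16 * (d * (d * T)))%N by exact: sum_near_close.
  by move: (hM u u) (hM u v) (hM v u) (hM v v); lia.
rewrite /M -!big_split /= big_mkcond /=; apply: leq_sum => q _.
rewrite -!big_split /=; case: ifP => [|//]; rewrite /conflict => /andP[_ pq].
rewrite -sum1dep_card big_mkcond /=; apply: leq_sum => r _; case: ifP => //.
move=> /andP[/andP[_ pr] /andP[_ ->]]; rewrite !muln1.
move: (close_near (val p) (val q)) (close_near (val p) (val r)).
rewrite pq pr -/u -/v; move: (near u _) (near v _) (near u _) (near v _).
by move=> a b a' b' ab ab'; rewrite -addnA -!mulnDr -mulnDl muln_gt0 ab ab'.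
Qed.

Lemma card_darts : #|{: {p in darts}}| = (#|G| * d)%N.
Proof.
rewrite -sum1_card (sum_darts (fun _ _ => 1%N)).
by under eq_bigr do rewrite regE; rewrite sum_nat_const.
Qed.

End Regular.

(** Separation forces disjointness: the partner in one edge of a shared vertex would be adjacent to
    the other edge. Hence distinct darts give distinct edges. *)
Lemma indep_induced_matching (W : {set {p in darts}}) : indep conflict W ->
  exists2 M : {set {set G}}, induced_matching M & #|M| = #|W|.
Proof.
move=> /indepP iW; pose E (p : {p in darts}) := [set (val p).1; (val p).2].
have endP p x : x \in E p -> exists2 y, y \in E p & adj x y.
  have := valP p; rewrite inE => pd; rewrite !inE => /orP[/eqP ->|/eqP ->].
    by exists (val p).2; rewrite // !inE eqxx orbT.
  by exists (val p).1; rewrite ?inE ?eqxx// adj_sym.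
have sep p q x y : p \in W -> q \in W -> p != q -> x \in E p -> y \in E q -> ~~ adj x y.
  move=> pW qW pq; have := iW p q pW qW; rewrite /conflict pq /= /close !negb_or.
  by move=> /and4P[h1 h2 h3 h4]; rewrite !inE => /orP[] /eqP -> /orP[] /eqP ->.
have disj p q x : p \in W -> q \in W -> p != q -> x \in E p -> x \notin E q.
  move=> pW qW pq xp; apply/negP => /endP[y yq]; apply/negP.
  exact: sep xp yq.
exists (E @: W); last first.
  apply: card_in_imset => p q pW qW pqE; apply/eqP; apply: contraT => pq.
  have xp : (val p).1 \in E p by rewrite !inE eqxx.
  by have := disj _ _ _ pW qW pq xp; rewrite -pqE xp.
split; [split|].
- apply/subsetP => _ /imsetP[p pW ->]; apply/imsetP; exists (val p) => //.
  by have := valP p; rewrite !inE.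
- move=> _ _ /imsetP[p pW ->] /imsetP[q qW ->] neq.
  have pq : p != q by apply: contraNneq neq => ->.
  rewrite disjoint_subset; apply/subsetP => x xp; rewrite inE; exact: disj xp.
- move=> _ _ /imsetP[p pW ->] /imsetP[q qW ->] neq x y.
  have pq : p != q by apply: contraNneq neq => ->.
  exact: sep.
Qed.

End Graph.

(** * Choice of parameters, and the split into small and large degree *)

Theorem theorem2 (R : realType) (H : sgraph) (hbip : bipartite H)
    (hB : (2 < #|H|)%N) :
  exists c : R, 0 < c /\
    forall n d : nat, (1 <= n)%N -> (1 <= d)%N ->
    forall G : sgraph, #|G| = n -> regular G d -> ~ has_subgraph G H ->
    exists M : {set {set G}}, induced_matching M /\
      c * (n%:R / d%:R) * ln (d%:R : R) <= #|M|%:R.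
Proof.
set s := #|H|; pose N : R := (1 + s + s ^ 2)%:R; pose t : R := s.+1%:R.
have N1 : 1 <= N by rewrite ler1n.
have t1 : 1 <= t by rewrite ler1n.
have m0 : 0 < 1024 * N * t by rewrite !mulr_gt0//; lra.
(* The product of the bounds 16 and [64 * N * t] met for small [d]; large [d] needs only
   [128 * t]. *)
exists (1024 * N * t)^-1; split; first by rewrite invr_gt0.
move=> n d n1 d1 G cG reg noH.
suff [W iW hW] : exists2 W : {set {p in @darts G}}, indep conflict W &
    n%:R / d%:R * ln (d%:R : R) <= 1024 * N * t * #|W|%:R.
  have [M iM cM] := indep_induced_matching W iW; exists M; split=> //.
  by rewrite cM -mulrA ler_pdivrMl.
have dR : 1 <= d%:R :> R by rewrite ler1n.
have d0 : 0 < d%:R :> R by rewrite ltr0n.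
pose L : R := ln d%:R; pose x : R := n%:R / d%:R.
have L0 : 0 <= L by apply: ln_ge0.
have x0 : 0 <= x by rewrite divr_ge0// ltW.
have cV : #|{: {p in @darts G}}|%:R = x * d%:R ^+ 2 :> R.
  by rewrite (card_darts d reg) cG natrM /x; field; rewrite gt_eqF.
pose Delta : R := 4 * d%:R ^+ 2.
have D1 : 1 <= Delta by rewrite /Delta; nra.
have hdeg p : #|[set q | @conflict G p q]|%:R <= Delta.
  by rewrite /Delta -natrX -natrM ler_nat conflict_degree.
have dd0 : 0 < d%:R ^+ 2 :> R by rewrite exprn_gt0.
(* This is [d ^ (1 / (4 * t))], so that [k ^ 4] can serve as [g] in [nbr_edges_le]. *)
pose k := expR (L / (4 * t)).
have lnk : ln k = L / (4 * t) by rewrite expRK.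
(* If [ln k < 16 * N], then [ln d] is bounded in terms of [H] and a bound without logarithm
   suffices. *)
have [Nk|kN] := leP (4 * (4 * N)) (ln k); last first.
  have [W iW hW] := bounded_degree_indep conflict Delta conflict_sym conflict_irr D1 hdeg.
  exists W => //; rewrite -/x -/L.
  have xW : x <= 16 * #|W|%:R.
    by rewrite -(ler_pM2r dd0) -cV; apply: le_trans hW _; rewrite /Delta; lra.
  have LN : L <= 64 * N * t.
    by move: kN; rewrite lnk ltr_pdivrMr; lra.
  have := ler_pM x0 L0 xW LN; lra.
have k1 : 1 <= k by rewrite -[leLHS]expR0 ler_expR divr_ge0//; lra.
have k0 : 0 < k by lra.
have kd : k <= d%:R.
  rewrite -[leRHS]lnK ?posrE// ler_expR -/L ler_pdivrMr; last lra.
  by rewrite ler_peMr//; lra.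
have kg : (k ^+ 4) ^+ s.+1 = d%:R.
  rewrite -exprM -expRM_natl natrM -/t -[RHS]lnK ?posrE// -/L; congr expR.
  by field; rewrite gt_eqF//; lra.
pose B : R := N * d%:R ^+ 2 / k ^+ 4.
have B0 : 0 <= B by rewrite divr_ge0 ?mulr_ge0 ?exprn_ge0//; lra.
have hT (a b : G) : (nbr_edges a b <= Num.truncn B)%N.
  rewrite truncn_ge_nat//; apply: (nbr_edges_le H) => //.
  by rewrite exprn_gt0.
pose lam : R := k ^+ 2 / Delta.
have lam0 : 0 <= lam by rewrite divr_ge0 ?exprn_ge0//; lra.
have lam4 : lam <= 4^-1.
  rewrite ler_pdivrMr; last lra.
  by rewrite /Delta mulKf ?pnatr_eq0// lerXn2r// nnegrE ltW.
(* [4 * N] serves as [K] in [sparse_indep], because [Delta ^ 2 = 16 * d ^ 4]. *)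
have hsp p : (\sum_(q | @conflict G p q) #|[set r | conflict p r && conflict q r]|)%:R
    <= 4 * N * Delta ^+ 2 / k ^+ 4.
  have := conflict_sparse d reg _ p hT; rewrite -(ler_nat R) => h.
  apply: le_trans h _; rewrite !natrM.
  have -> : 4 * N * Delta ^+ 2 / k ^+ 4 = 64 * (d%:R * (d%:R * B)).
    by rewrite /Delta /B; field; rewrite gt_eqF.
  by rewrite !ler_wpM2l// truncn_le.
have [|W iW hW] := sparse_indep conflict conflict_sym conflict_irr lam lam0
  Delta k (4 * N) _ k1 erefl lam4 Nk hdeg hsp; first by lra.
exists W => //; rewrite -/x -/L.
have LE : L = 4 * t * ln k by rewrite lnk; field; rewrite gt_eqF//; lra.
have xW : x * ln k <= 32 * #|W|%:R.
  rewrite -(ler_pM2r dd0); move: hW; rewrite cV /Delta; lra.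
have w0 := ler0n R #|W|.
have : x * L <= 128 * t * #|W|%:R by rewrite LE; nra.
move=> h; apply: le_trans h _; rewrite ler_wpM2r//; nra.
Qed.
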